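(* Let $(M,g)$ be a connected, compact, orientable Riemannian manifold, and let $\{\psi_i\} \subseteq \mathrm{Diff}^{\infty}(M)$ be a sequence of smooth diffeomorphisms with $\psi_i \to \psi$ in $C^0$, where $\psi \in \mathrm{Diff}^{\infty}(M)$. If for a closed $1$-form $\eta$ on $M$ the sequence of pullbacks $\psi_i^*\eta$ converges uniformly to a $1$-form $\theta$, then $\theta = \psi^*\eta$.
   Context: $\mathrm{Diff}^{\infty}(M)$ is the group of smooth diffeomorphisms of $M$. $\psi_i \to \psi$ in $C^0$ means $\sup_{x\in M} d_g(\psi_i(x),\psi(x)) \to 0$, where $d_g$ is the Riemannian distance. Differential forms are smooth. Uniform convergence of forms is convergence in the supremum norm $|\alpha|_0 = \sup_{x\in M}|\alpha(x)|$, with $|\alpha(x)|$ the pointwise norm induced by $g$. *)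

(* Defs.v *)
From HB Require Import structures.
From mathcomp Require Import all_boot all_order all_algebra.
From mathcomp Require Import all_classical all_reals all_analysis.

Set Implicit Arguments.
Unset Strict Implicit.
Unset Printing Implicit Defensive.
Import Order.TTheory GRing.Theory Num.Theory.
Import numFieldNormedType.Exports.
Local Open Scope classical_set_scope.
Local Open Scope ring_scope.

(* C^k on an open set [U] of a finite-dimensional normed space.  Asking that
   the directional derivatives ['D_v f] be C^k for all fixed [v] amounts to
   asking that [x |-> 'd f x] be C^k, since the dimension is finite. *)
Fixpoint Ck {R : realType} {V W : normedModType R} (k : nat) (U : set V)
    (f : V -> W) : Prop :=
  if k is k'.+1 then
    (forall x, U x -> differentiable f x) /\ forall v, Ck k' U ('D_v f)
  else {in U, continuous f}.

Definition smooth_on {R : realType} {V W : normedModType R} (U : set V)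
  (f : V -> W) : Prop := forall k, Ck k U f.

(* The values of [chart_map] off [chart_dom], and of [chart_inv] off the image
   of [chart_dom], carry no meaning. *)
Record chart (R : realType) (n : nat) (X : topologicalType) := Chart {
  chart_dom : set X ;
  chart_map :> X -> 'rV[R]_n ;
  chart_inv : 'rV[R]_n -> X ;
  chart_dom_open : open chart_dom ;
  chart_img_open : open (chart_map @` chart_dom) ;
  chart_mapK : {in chart_dom, cancel chart_map chart_inv} ;
  chart_map_cont : {in chart_dom, continuous chart_map} ;
  chart_inv_cont : {in chart_map @` chart_dom, continuous chart_inv} }.

Definition chart_img (R : realType) n (X : topologicalType) (c : chart R n X) :
  set 'rV[R]_n := c @` chart_dom c.

Definition transition_smooth (R : realType) n (X : topologicalType)
    (c d : chart R n X) : Prop :=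
  smooth_on (c @` (chart_dom c `&` chart_dom d)) (d \o chart_inv c).

(* Smooth n-manifolds without boundary.  The atlas need not be maximal;
   [chart_at] selects a chart of the atlas around each point. *)
Record manifold (R : realType) (n : nat) := Manifold {
  mf_space :> topologicalType ;
  mf_hausdorff : hausdorff_space mf_space ;
  mf_second_countable : @second_countable mf_space ;
  atlas : set (chart R n mf_space) ;
  chart_at : mf_space -> chart R n mf_space ;
  chart_at_atlas : forall x, atlas (chart_at x) ;
  chart_at_dom : forall x, chart_dom (chart_at x) x ;
  atlas_compat : forall c d, atlas c -> atlas d -> transition_smooth c d }.

(* Charts of the maximal atlas. *)
Definition smooth_chart (R : realType) n (M : manifold R n)
    (c : chart R n M) : Prop :=
  forall d, atlas d -> transition_smooth c d /\ transition_smooth d c.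

Definition orientable (R : realType) n (M : manifold R n) : Prop :=
  exists A : set (chart R n M),
    [/\ forall c, A c -> smooth_chart c,
        forall x : M, exists2 c, A c & chart_dom c x
      & forall c d x, A c -> A d -> chart_dom c x -> chart_dom d x ->
          0 < \det ('J (d \o chart_inv c) (c x))].

(* T_x M is identified with R^n through the coordinates of the selected chart
   [chart_at M x]. *)
Definition tangent (R : realType) n (M : manifold R n) (x : M) :
  normedModType R := 'rV[R]_n.

(* The tangent vector at [x] whose coordinates in the chart [c] are [v]. *)
Definition vec_of (R : realType) n (M : manifold R n) (c : chart R n M) (x : M)
    (v : 'rV[R]_n) : tangent x :=
  'd (chart_at x \o chart_inv c) (c x) v.

Definition smooth_map (R : realType) m n (M : manifold R m) (N : manifold R n)
    (f : M -> N) : Prop :=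
  continuous f /\
  forall c d, atlas c -> atlas d ->
    smooth_on (c @` (chart_dom c `&` f @^-1` chart_dom d))
              (d \o f \o chart_inv c).

Definition diffeomorphism (R : realType) n (M : manifold R n) (f : M -> M) :
    Prop :=
  smooth_map f /\
  exists h : M -> M, [/\ smooth_map h, cancel f h & cancel h f].

Definition mdiff (R : realType) m n (M : manifold R m) (N : manifold R n)
    (f : M -> N) (x : M) (v : tangent x) : tangent (f x) :=
  'd (chart_at (f x) \o f \o chart_inv (chart_at x)) (chart_at x x) v.
Arguments mdiff {R m n M N} f x v.

(* A field of functions on the tangent spaces, e.g. a (not necessarily
   smooth) field of covectors. *)
Definition cofield (R : realType) n (M : manifold R n) :=
  forall x : M, tangent x -> R.

(* [coef a c v z] is the value of [a] on the coordinate field of [c] with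
   constant coordinates [v], at the point of coordinates [z]: for
   a = \sum_i a_i dz_i it is \sum_i a_i(z) v_i. *)
Definition coef (R : realType) n (M : manifold R n) (a : cofield M)
    (c : chart R n M) (v z : 'rV[R]_n) : R :=
  a (chart_inv c z) (vec_of c (chart_inv c z) v).

Record one_form (R : realType) n (M : manifold R n) := OneForm {
  form_val :> cofield M ;
  form_linear : forall (x : M), scalar (@form_val x) ;
  form_smooth : forall c, atlas c -> forall v,
    smooth_on (chart_img c) (coef form_val c v) }.
Arguments form_val {R n M} _ x _.

(* The expression in the chart [c] of the exterior derivative:
   (da)(v, w) = \sum_(i, j) (d_i a_j - d_j a_i) v_i w_j
   is v(a(w)) - w(a(v)) for the constant fields [v] and [w]. *)
Definition ext_d (R : realType) n (M : manifold R n) (a : cofield M)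
    (c : chart R n M) (z v w : 'rV[R]_n) : R :=
  'D_v (coef a c w) z - 'D_w (coef a c v) z.

Definition closed_form (R : realType) n (M : manifold R n) (a : one_form M) :
    Prop :=
  forall c, atlas c -> forall z, chart_img c z -> forall v w,
    ext_d a c z v w = 0.

Definition pullback (R : realType) m n (M : manifold R m) (N : manifold R n)
    (f : M -> N) (a : cofield N) : cofield M :=
  fun x v => a (f x) (mdiff f x v).

Record riemannian_metric (R : realType) n (M : manifold R n) := RMetric {
  metric_val :> forall x : M, tangent x -> tangent x -> R ;
  metric_linear : forall (x : M) (w : tangent x),
    scalar (fun v : tangent x => metric_val v w) ;
  metric_sym : forall (x : M) (v w : tangent x),
    metric_val v w = metric_val w v ;
  metric_pos : forall (x : M) (v : tangent x), v != 0 -> 0 < metric_val v v ;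
  metric_smooth : forall c, atlas c -> forall v w : 'rV[R]_n,
    smooth_on (chart_img c)
      (fun z => metric_val (vec_of c (chart_inv c z) v)
                           (vec_of c (chart_inv c z) w)) }.
Arguments metric_val {R n M} _ x _ _.

(* Smooth on [0, 1] means smooth on some open neighbourhood of [0, 1]. *)
Definition smooth_segment (R : realType) n (M : manifold R n) (s : R -> M) :
    Prop :=
  exists U : set R,
    [/\ open U, `[0, 1] `<=` U, {in U, continuous s}
      & forall c, atlas c -> smooth_on (U `&` s @^-1` chart_dom c) (c \o s)].

Definition velocity (R : realType) n (M : manifold R n) (s : R -> M) (t : R) :
  tangent (s t) := 'D_1 (chart_at (s t) \o s) t.

Definition segment_length (R : realType) n (M : manifold R n)
    (g : riemannian_metric M) (s : R -> M) : \bar R :=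
  (\int[lebesgue_measure]_(t in `[0%R, 1%R])
     (Num.sqrt (g (s t) (velocity s t) (velocity s t)))%:E)%E.

(* A piecewise smooth curve from [x] to [y], given by its finitely many smooth
   pieces, each parametrized by [0, 1]. *)
Fixpoint piecewise_smooth (R : realType) n (M : manifold R n) (x : M)
    (p : seq (R -> M)) (y : M) : Prop :=
  if p is s :: p' then
    [/\ smooth_segment s, s 0 = x & piecewise_smooth (s 1) p' y]
  else x = y.

Definition curve_length (R : realType) n (M : manifold R n)
    (g : riemannian_metric M) (p : seq (R -> M)) : \bar R :=
  (\sum_(s <- p) segment_length g s)%E.

Definition riemannian_dist (R : realType) n (M : manifold R n)
    (g : riemannian_metric M) (x y : M) : \bar R :=
  ereal_inf [set curve_length g p | p in [set p | piecewise_smooth x p y]].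

Definition C0_dist (R : realType) n (M : manifold R n)
    (g : riemannian_metric M) (f h : M -> M) : \bar R :=
  ereal_sup [set riemannian_dist g (f x) (h x) | x in [set: M]].

Definition C0_cvg (R : realType) n (M : manifold R n)
    (g : riemannian_metric M) (f_ : nat -> M -> M) (f : M -> M) : Prop :=
  C0_dist g (f_ i) f @[i --> \oo] --> 0%E.

Definition covector_norm (R : realType) n (M : manifold R n)
    (g : riemannian_metric M) (x : M) (l : tangent x -> R) : \bar R :=
  ereal_sup [set (`|l v|)%:E | v in [set v : tangent x | g x v v <= 1]].

Definition sup_norm (R : realType) n (M : manifold R n)
    (g : riemannian_metric M) (a : cofield M) : \bar R :=
  ereal_sup [set covector_norm g (a x) | x in [set: M]].

Definition uniform_cvg (R : realType) n (M : manifold R n)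
    (g : riemannian_metric M) (a_ : nat -> cofield M) (a : cofield M) : Prop :=
  sup_norm g (fun x v => a_ i x v - a x v) @[i --> \oo] --> 0%E.

(* Main.v *)
Require Import Defs.
From HB Require Import structures.
From mathcomp Require Import all_boot all_order all_algebra.
From mathcomp Require Import all_classical all_reals all_analysis.
From mathcomp Require Import ring lra.
Set Implicit Arguments.
Unset Strict Implicit.
Unset Printing Implicit Defensive.
Import Order.TTheory GRing.Theory Num.Theory.
Import numFieldNormedType.Exports.
Local Open Scope classical_set_scope.
Local Open Scope ring_scope.

(** Both sides are compared at a point [x0] on a vector [v].

    Near [psi x0] the closed form [eta] has, in coordinates, a primitive [F]
    ([closed_has_primitive], [closed_form_primitive]).  Let [t |-> x t] be the
    coordinate line through [x0] with direction [v].  For large [i] and small [t]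
    the points [psi_ i (x t)] stay in the domain of [F], and the functions
    [f_ i t = F (psi_ i (x t))] have as derivative the value of
    [pullback (psi_ i) eta] on the velocity of the line
    ([pullback_derive_line]).  These derivatives converge uniformly to the value
    of [theta], while [f_ i] converges pointwise to [f t = F (psi (x t))] because
    [psi_ i] converges to [psi].  So the derivative of [f] at 0, which is
    [pullback psi eta] at [x0] on [v], is equal to [theta] at [x0] on [v]
    ([derivative_of_uniform_limit]).  The primitive is what removes the
    derivatives of [psi_ i], about which nothing is known, from the limit.

    The convergence [psi_ i --> psi] is measured by the Riemannian distance, an
    infimum of lengths of piecewise smooth paths of the manifold, whereas [F]
    lives in a chart.  The link is [riemannian_dist_chart]: on a small coordinate
    ball the metric is bounded below by a multiple of the coordinate norm
    ([metric_coef_lower_bound]), so that a path that is short for the metric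
    cannot leave the ball and joins points with close coordinates
    ([segment_start_close], [path_start_close]).

    Uniform convergence of forms is measured by the metric as well; along the
    line it gives uniform convergence of the coefficients in the direction [v]
    since the Riemannian norm of [v] is locally bounded ([sup_norm_bound]). *)

(** * Calculus on the line *)

(** The mean value inequality with a variable bound: both [l - f] and [l + f]
    are nondecreasing.  With [l] an arc length it bounds a displacement, with
    [l] linear it is the usual mean value inequality. *)
Lemma derive_le_increment (R : realType) (f l f' l' : R -> R) (a b : R) :
  a <= b ->
  (forall t, t \in `]a, b[ -> is_derive t 1 f (f' t)) ->
  (forall t, t \in `]a, b[ -> is_derive t 1 l (l' t)) ->
  (forall t, t \in `]a, b[ -> `|f' t| <= l' t) ->
  {within `[a, b], continuous f} -> {within `[a, b], continuous l} ->
  `|f b - f a| <= l b - l a.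
Proof.
move=> ab df dl f'l' cf cl.
have mono (g g' : R -> R) : (forall t, t \in `]a, b[ -> is_derive t 1 g (g' t)) ->
    (forall t, t \in `]a, b[ -> 0 <= g' t) -> {within `[a, b], continuous g} ->
    g a <= g b.
  move=> dg g'0 cg.
  have := @ger0_derive1_le_cc _ g a b _ _ cg; apply => //.
  - by move=> t /dg [].
  - by move=> t tab; rewrite derive1E; have /@derive_val -> := dg _ tab; exact: g'0.
  - by rewrite in_itv /= lexx ab.
  - by rewrite in_itv /= lexx ab.
rewrite ler_norml; apply/andP; split.
  suff : (l + f) a <= (l + f) b by rewrite /= !fctE; lra.
  apply: (mono _ (fun t => l' t + f' t)).
  - by move=> t tab; have := df _ tab; have := dl _ tab => dlt dft; apply: is_deriveD.
  - by move=> t /f'l'; rewrite ler_norml => /andP[]; lra.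
  - move=> t; apply: continuousD _; [exact: cl|exact: cf].
suff : (l - f) a <= (l - f) b by rewrite /= !fctE; lra.
apply: (mono _ (fun t => l' t - f' t)).
- by move=> t tab; have := df _ tab; have := dl _ tab => dlt dft; apply: is_deriveB.
- by move=> t /f'l'; rewrite ler_norml => /andP[]; lra.
- move=> t; apply: continuousD _; first exact: cl.
  by apply: continuousN; exact: cf.
Qed.

(** Continuity is only available at the points of [[0, 1]], so the derivative
    is claimed on the open interval.  The last clause recovers lengths of
    curves, which are integrals over [[0, 1]]. *)
Lemma exists_antiderivative (R : realType) (f : R -> R) :
  (forall t, t \in `[0, 1] -> {for t, continuous f}) ->
  exists A : R -> R, [/\ A 0 = 0, {within `[0, 1], continuous A},
    forall t : R, t \in `]0, 1[ -> is_derive t 1 A (f t) &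
    (\int[lebesgue_measure]_(t in `[0%R, 1%R]) (f t)%:E)%E = (A 1)%:E].
Proof.
move=> cf.
have intf : lebesgue_measure.-integrable `[0:R, 1] (EFin \o f).
  apply: continuous_compact_integrable; first exact: segment_compact.
  by apply: continuous_in_subspaceT => t; rewrite inE => /cf.
exists (fun x => (\int[lebesgue_measure]_(t in `[0, x]) f t)%R); split.
- by rewrite set_itv1 Rintegral_set1.
- exact: (parameterized_integral_continuous ler01 intf).
- move=> t; rewrite in_itv /= => /andP[t0 t1].
  have [] := continuous_FTC1_closed t1 intf t0 (cf _ _).
    by rewrite in_itv /= !ltW.
  by move=> dA; rewrite derive1E => <-; exact: derivableP.
- by rewrite /Rintegral fineK//; exact: integrable_fin_num.
Qed.

(** * Differentials, row vectors and uniform continuity *)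

Lemma near_normP (R : realType) (V : normedModType R) (x : V) (P : set V) :
  (\forall y \near x, P y) <->
  exists2 d, 0 < d & forall y, `|y - x| < d -> P y.
Proof.
apply: (iff_trans (nbhs_ballP x P)); split=> -[d /= d0 dP]; exists d => //= y.
  by move=> yx; apply: dP; rewrite -ball_normE /= distrC.
by rewrite -ball_normE /= distrC; exact: dP.
Qed.

(** The little-o in the definition of differentiability, in epsilon form. *)
Lemma is_diff_epsP (R : realType) (V W : normedModType R) (f : V -> W)
    (L : {linear V -> W}) (x : V) :
  is_diff x f L <->
  continuous L /\ forall e, 0 < e ->
    \forall y \near x, `|f y - f x - L (y - x)| <= e * `|y - x|.
Proof.
have E : (f \o shift x = cst (f x) + L +o_ 0 id) <->
  forall e, 0 < e -> \forall y \near x, `|f y - f x - L (y - x)| <= e * `|y - x|.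
  split.
    move=> /eqaddoP H e /H /near_normP[d d0 Hd]; apply/near_normP; exists d => // y yx.
    have := Hd (y - x); rewrite subr0 !fctE /= subrK => /(_ yx).
    by rewrite opprD addrA.
  move=> H; apply/eqaddoP => e /H /near_normP[d d0 Hd]; apply/near_normP.
  exists d => // y; rewrite subr0 => yd; have := Hd (y + x).
  by rewrite !fctE /= addrK opprD addrA; exact.
split.
  move=> [df dE]; have Lc : continuous L by rewrite -dE; exact: diff_continuous.
  by split=> //; apply/E; rewrite -dE; exact: diff_locally.
move=> [Lc /E H]; have dE := diff_unique Lc H.
split; last exact: dE.
by apply/diff_locallyP; rewrite dE.
Qed.

Lemma near_eq_is_diff (R : realType) (V W : normedModType R) (f g : V -> W)
    (df : V -> W) (x : V) :
  (\forall y \near x, f y = g y) -> is_diff x f df -> is_diff x g df.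
Proof.
move=> fg dfx; have <- := @diff_val _ _ _ _ _ _ _ dfx.
have /is_diff_epsP[dc H] : is_diff x f ('d f x) by apply: differentiableP.
apply/is_diff_epsP; split=> // e /H.
move: (fg); apply: filterS2 => y <-; by rewrite (nbhs_singleton fg).
Qed.

Lemma norm_row_coord (R : realType) n (v : 'rV[R]_n) i : `|v 0 i| <= `|v|.
Proof.
by rewrite [leRHS]/Num.Def.normr /= mx_normrE; exact: (le_bigmax _ _ (0, i)).
Qed.

Lemma norm_row_le (R : realType) n (v : 'rV[R]_n) (C : R) :
  0 <= C -> (forall i, `|v 0 i| <= C) -> `|v| <= C.
Proof.
move=> C0 H; rewrite [leLHS]/Num.Def.normr /= mx_normrE bigmax_le// => -[i j] _.
by rewrite ord1; exact: H.
Qed.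

Lemma scalar_row_sum (R : realType) n (L : 'rV[R]_n -> R) (v : 'rV[R]_n) :
  scalar L -> L v = \sum_j v 0 j * L (delta_mx 0 j).
Proof.
move=> linL.
pose L' : {scalar 'rV[R]_n} := HB.pack L (GRing.isLinear.Build _ _ _ _ L linL).
rewrite -[L]/(L' : _ -> _) {1}(row_sum_delta v) linear_sum.
by apply: eq_bigr => j _; rewrite linearZ.
Qed.

(** This makes estimates of a difference of linear forms uniform in the vector:
    only the finitely many values on the canonical basis matter. *)
Lemma scalar_row_bound (R : realType) n (L : 'rV[R]_n -> R) (v : 'rV[R]_n) :
  scalar L -> `|L v| <= `|v| * \sum_j `|L (delta_mx 0 j)|.
Proof.
move=> linL; rewrite (scalar_row_sum v linL) mulr_sumr.
apply: (le_trans (ler_norm_sum _ _ _)); apply: ler_sum => j _.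
by rewrite normrM ler_wpM2r// norm_row_coord.
Qed.

(** Only the first point is required to lie in the compact set, so that this is
    stronger than uniform continuity on [K]; the second point is kept in the
    open set [U] by compactness too. *)
Lemma compact_unif_continuity (R : realType) (V : normedModType R) (m : nat)
    (f : 'I_m -> V -> R) (K U : set V) (e : R) :
  compact K -> open U -> K `<=` U ->
  (forall j x, U x -> {for x, continuous (f j)}) -> 0 < e ->
  exists2 d, 0 < d & forall x y, K x -> `|y - x| < d ->
    U y /\ \sum_j `|f j y - f j x| < e.
Proof.
move=> cK oU KU cf e0.
have loc x : K x -> exists2 r, 0 < r & forall z, `|z - x| < r ->
    U z /\ \sum_j `|f j z - f j x| < e / 2.
  move=> Kx; apply/near_normP; apply: filterI.
    by move/KU: Kx; rewrite openE in oU; exact: oU.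
  have H : (\sum_j `|f j z - f j x|) @[z --> x] --> \sum_j `|f j x - f j x|.
    apply: cvg_big => [|j _]; first exact: add_continuous.
    apply: cvg_norm; apply: cvgB; last exact: cvg_cst.
    by apply: cf; exact: KU.
  rewrite big1 in H; last by move=> j _; rewrite subrr normr0.
  have e20 : 0 < e / 2 by rewrite divr_gt0.
  move/cvgrPdist_lt : H => /(_ _ e20); apply: filterS => z.
  by rewrite sub0r normrN; apply: le_lt_trans; exact: ler_norm.
have /(_ _ (0 : R)^'+ (fun d x => forall y, `|y - x| < d ->
    U y /\ \sum_j `|f j y - f j x| < e)) := (compact_near_coveringP K).1 cK.
move=> /(_ _)[].
  move=> x /loc [r r0 H].
  have r20 : 0 < r / 2 by rewrite divr_gt0.
  exists ([set z | `|z - x| < r / 2], [set d | d < r / 2]).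
    split; first by apply/near_normP; exists (r / 2).
    exact: nbhs_right_lt.
  move=> [z d] /= [zx dr] y yz.
  have /H[Uy yx] : `|y - x| < r.
    have := ler_distD z y x; lra.
  have /H[_ zx'] : `|z - x| < r by lra.
  split=> //; apply: le_lt_trans (_ : \sum_j `|f j y - f j x| +
    \sum_j `|f j z - f j x| < e); last lra.
  rewrite -big_split /=; apply: ler_sum => j _.
  by rewrite (distrC (f j z)); exact: ler_distD.
move=> d /= d0 H; exists (d / 2); first by rewrite divr_gt0.
move=> x y Kx; apply: (H (d / 2)) => //=; last by rewrite divr_gt0.
by rewrite sub0r normrN gtr0_norm ?divr_gt0//; lra.
Qed.

(** * The Poincare lemma on a ball *)

Lemma scalar_row_continuous (R : realType) n (L : 'rV[R]_n -> R) :
  scalar L -> continuous L.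
Proof.
move=> linL.
pose L' : {scalar 'rV[R]_n} := HB.pack L (GRing.isLinear.Build _ _ _ _ L linL).
apply: (@bounded_linear_continuous _ _ _ L'); apply/linear_boundedP.
near=> C => v; apply: (le_trans (scalar_row_bound v linL)).
rewrite mulrC ler_wpM2r//; near: C.
Unshelve. all: by end_near. Qed.

Lemma is_derive_line (R : realType) (V W : normedModType R) (f : V -> W)
    (x v : V) (t : R) : differentiable f (x + t *: v) ->
  is_derive t 1 (fun s => f (x + s *: v)) ('D_v f (x + t *: v)).
Proof.
move=> df.
have dl : is_diff t (fun s : R => x + s *: v) ( *:%R^~ v).
  have := @is_diffD _ _ _ (cst x : R -> V) ( *:%R^~ v) 0 ( *:%R^~ v) t
    (is_diff_cst _ _) (is_diff_scalel _ _).
  by rewrite add0r.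
have dg := differentiableP df.
have dc : is_diff t (f \o (fun s : R => x + s *: v)) ('d f (x + t *: v) \o ( *:%R^~ v)).
  exact: is_diff_comp.
apply: DeriveDef; first by apply: diff_derivable; case: dc.
rewrite deriveE; last by case: dc.
by rewrite (@diff_val _ _ _ _ _ _ _ dc) /= scale1r deriveE.
Qed.

Lemma is_derive_mulrr (R : realType) (c t : R) :
  is_derive t 1 (fun s : R => s * c) c.
Proof.
have : is_derive t 1 (id * cst c : R -> R) (t *: 0 + c *: 1).
  by apply: is_deriveM.
by rewrite scaler0 add0r [_ *: _]mulr1.
Qed.

Lemma derive_scale (R : realType) (V W : normedModType R) (f : V -> W)
    (x v : V) (c : R) : differentiable f x -> 'D_(c *: v) f x = c *: 'D_v f x.
Proof. by move=> df; rewrite !deriveE// linearZ. Qed.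

Lemma within_continuous_line (R : realType) (V W : normedModType R) (f : V -> W)
    (x v : V) (A : set R) :
  (forall t, A t -> {for x + t *: v, continuous f}) ->
  {within A, continuous (fun t : R => f (x + t *: v))}.
Proof.
move=> cf; apply: continuous_in_subspaceT => t; rewrite inE => At.
apply: (@continuous_comp _ _ _ (fun t : R => x + t *: v) f); last exact: cf.
by apply: cvgD; [exact: cvg_cst|exact: scalel_continuous].
Qed.

Lemma within_continuousM (R : realType) (A : set R) (f g : R -> R) :
  {within A, continuous f} -> {within A, continuous g} ->
  {within A, continuous (fun t => f t * g t)}.
Proof. by move=> cf cg t; apply: (@continuousM R (subspace A) f g); [exact: cf|exact: cg]. Qed.

(** The mean value inequality applied to the function
    [t |-> f (x + t u) - t 'D_u f x], whose derivative is the oscillation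
    of ['D_u f]. *)
Lemma first_order_remainder (R : realType) (V : normedModType R) (f : V -> R)
    (x u : V) (c : R) :
  (forall t : R, t \in `[0, 1] -> differentiable f (x + t *: u)) ->
  (forall t : R, t \in `[0, 1] -> `|'D_u f (x + t *: u) - 'D_u f x| <= c) ->
  `|f (x + u) - f x - 'D_u f x| <= c.
Proof.
move=> df dc; pose g (t : R) := f (x + t *: u) - t * 'D_u f x.
have oo_cc (t : R) : t \in `]0, 1[ -> t \in `[0, 1] by exact: subset_itv_oo_cc.
have dl := @is_derive_mulrr R.
have cl (k : R) : continuous (fun s : R => s * k) by move=> s; exact: mulrr_continuous.
have := @derive_le_increment R g (fun t => t * c)
  (fun t => 'D_u f (x + t *: u) - 'D_u f x) (fun=> c) 0 1 ler01.
rewrite /g scale1r scale0r addr0 !mul0r !mul1r !subr0.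
rewrite [X in `|X| <= _](_ : _ = f (x + u) - f x - 'D_u f x); last by ring.
apply.
- move=> t /oo_cc t01; apply: is_deriveB.
  exact/is_derive_line/df.
- by move=> t /oo_cc; exact: dc.
- have cf : {within `[0, 1], continuous (fun t : R => f (x + t *: u))}.
    by apply: within_continuous_line => t t01; exact/differentiable_continuous/df.
  exact: (within_continuousB cf (continuous_subspaceT (cl _))).
- by apply: continuous_subspaceT; exact: cl.
Qed.

Lemma scalar_sub (R : realType) (V : normedModType R) (f g : V -> R) :
  scalar f -> scalar g -> scalar (fun v => f v - g v).
Proof. by move=> fl gl c u v; rewrite fl gl /GRing.scale /=; ring. Qed.

(** The primitive is the integral of [w] along the segments issued from the
    center [y0].  To differentiate it at [a] in the direction [h = b - a], write
    [p t] for the point of parameter [t] of the segment from [y0] to [a], and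
    compare the antiderivatives of [w] along the segments to [b] and to [a] with
    [t * w h (p t)].  Since [w] is closed, the derivative of
    [t |-> t * w h (p t)] is the first-order variation of the integrand in the
    direction [h]; hence the derivative in [t] of the difference is a
    remainder of order [o(h)], uniformly in [t] by compactness of the segment.
    No derivative has to be exchanged with an integral. *)
Lemma closed_has_primitive (R : realType) n (w : 'rV[R]_n -> 'rV[R]_n -> R)
    (y0 : 'rV[R]_n) (r : R) :
  (forall y, scalar (w ^~ y)) ->
  (forall v y, `|y - y0| < r -> differentiable (w v) y) ->
  (forall u v y, `|y - y0| < r -> {for y, continuous ('D_u (w v))}) ->
  (forall u v y, `|y - y0| < r -> 'D_u (w v) y = 'D_v (w u) y) ->
  exists F : 'rV[R]_n -> R, forall a, `|a - y0| < r -> is_diff a F (w ^~ a).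
Proof.
move=> wl wd wc wclosed.
have wD u v y : w (u + v) y = w u y + w v y.
  by have := wl y 1 u v; rewrite scale1r mul1r.
have wcont v y : `|y - y0| < r -> {for y, continuous (w v)}.
  by move=> yr; exact/differentiable_continuous/wd.
have inB a (t : R) : `|a - y0| < r -> t \in `[0, 1] ->
    `|y0 + t *: (a - y0) - y0| < r.
  rewrite in_itv /= => ar /andP[t0 t1]; rewrite addrAC subrr add0r normrZ.
  by rewrite ger0_norm//; apply: le_lt_trans ar; rewrite ler_piMl.
pose G b (t : R) := w (b - y0) (y0 + t *: (b - y0)).
have /choice[A HA] : forall b, exists A : R -> R, `|b - y0| < r ->
    [/\ A 0 = 0, {within `[0, 1], continuous A} &
      forall t : R, t \in `]0, 1[ -> is_derive t 1 A (G b t)].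
  move=> b; have [bB|] := pselect (`|b - y0| < r); last by exists (fun=> 0).
  have [t t01|A []] := @exists_antiderivative _ (G b).
    apply: (@continuous_comp _ _ _ (fun t : R => y0 + t *: (b - y0)) (w (b - y0))).
      by apply: cvgD; [exact: cvg_cst|exact: scalel_continuous].
    exact/wcont/inB.
  by exists A.
exists (fun b => A b 1) => a aB.
pose L : {scalar 'rV[R]_n} := HB.pack (w ^~ a) (GRing.isLinear.Build _ _ _ _ _ (wl a)).
apply/(is_diff_epsP _ L); split; first exact: scalar_row_continuous (wl a).
move=> e e0; have e20 : 0 < e / 2 by rewrite divr_gt0.
pose p (t : R) := y0 + t *: (a - y0).
pose K := p @` `[0, 1].
pose U : set 'rV[R]_n := [set y | `|y - y0| < r].
have cK : compact K.
  apply: continuous_compact; last exact: segment_compact.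
  apply: continuous_subspaceT => t.
  by apply: cvgD; [exact: cvg_cst|exact: scalel_continuous].
have oU : open U.
  have -> : U = ball y0 r.
    by rewrite -ball_normE /=; apply/seteqP; split=> y /=; rewrite /U /= distrC.
  exact: ball_open.
have KU : K `<=` U by move=> _ [t t01 <-]; exact: inB.
(* d1 controls the oscillation of w near the segment, d2 the one of its
   directional derivatives. *)
have [d1 d10 H1] := @compact_unif_continuity _ _ n (fun j => w (delta_mx 0 j)) K U
  (e / 2) cK oU KU (fun j => @wcont _) e20.
have [d2 d20 H2] := @compact_unif_continuity _ _ n
  (fun j => 'D_(delta_mx 0 j) (w (a - y0))) K U (e / 2) cK oU KU
  (fun j => @wc _ _) e20.
apply/near_normP; exists (Num.min (r - `|a - y0|) (Num.min d1 d2)).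
  by rewrite !lt_min d10 d20 subr_gt0 aB.
move=> b; rewrite !lt_min => /and3P[ba bd1 bd2].
have bB : `|b - y0| < r by have := ler_distD a b y0; lra.
pose h := b - a; pose k := a - y0.
have hk : b - y0 = h + k by rewrite /h /k addrA subrK.
have [A0a Aca Ada] := HA _ aB; have [A0b Acb Adb] := HA _ bB.
pose f (t : R) := A b t - A a t - t * w h (p t).
pose f' (t : R) := G b t - G a t - (t * 'D_k (w h) (p t) + w h (p t)).
have oo_cc (t : R) : t \in `]0, 1[ -> t \in `[0, 1] by exact: subset_itv_oo_cc.
have dl := @is_derive_mulrr R.
have cl (c : R) : continuous (fun s : R => s * c) by move=> s; exact: mulrr_continuous.
have := @derive_le_increment R f (fun t => t * (e * `|h|)) f' (fun=> e * `|h|) 0 1 ler01.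
rewrite /f A0a A0b !mul0r !mul1r !subr0 /p scale1r subrKC; apply.
- move=> t t01; apply: is_deriveB.
    by apply: is_deriveB; [exact: Adb|exact: Ada].
  have dt : is_derive t 1 (fun s => w h (p s)) ('D_k (w h) (p t)).
    by apply: is_derive_line; apply/wd/inB => //; exact: oo_cc.
  have : is_derive t 1 (id * (fun s => w h (p s)) : R -> R)
      (t *: 'D_k (w h) (p t) + w h (p t) *: 1) by apply: is_deriveM.
  by rewrite [_ *: 1]mulr1.
- move=> t /oo_cc t01.
  pose q := y0 + t *: (b - y0).
  have t01' : 0 <= t <= 1 by move: t01; rewrite in_itv.
  have qp : q = p t + t *: h by rewrite /q hk scalerDr /p -/k addrA addrAC.
  have Kp : K (p t) by exists t.
  have th : `|t *: h| <= `|h|.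
    by case/andP: t01' => t0 t1; rewrite normrZ ger0_norm// ler_piMl.
  (* The closedness of w turns 'D_k (w h), with k = a - y0, into 'D_h (w k). *)
  have -> : f' t = (w h q - w h (p t)) +
      (w k (p t + t *: h) - w k (p t) - 'D_(t *: h) (w k) (p t)).
    rewrite derive_scale; last by apply/wd/KU.
    rewrite wclosed; last exact: KU.
    rewrite /f' /G -/q -/k -/(p t) hk wD -qp /GRing.scale /=; ring.
  apply: (le_trans (ler_normD _ _)); rewrite (splitr e) mulrDl lerD//.
    have linqp := scalar_sub (wl q) (wl (p t)).
    apply: (le_trans (scalar_row_bound h linqp)).
    rewrite mulrC ler_wpM2r//; apply/ltW.
    have [||//] := H1 (p t) q; first exact: Kp.
    by rewrite qp addrAC subrr add0r (le_lt_trans th).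
  have in2 (s : R) : s \in `[0, 1] -> `|p t + s *: (t *: h) - p t| < d2.
    rewrite in_itv /= => /andP[s0 s1]; rewrite addrAC subrr add0r normrZ.
    rewrite (ger0_norm s0); apply: le_lt_trans bd2; apply: le_trans th.
    by rewrite ler_piMl.
  apply: first_order_remainder => s /in2 s2.
    by apply: wd; have [] := H2 _ _ Kp s2.
  have [Us Hs] := H2 _ _ Kp s2.
  rewrite deriveE; last exact: wd.
  rewrite deriveE; last exact/wd/KU.
  pose D v := 'd (w k) (p t + s *: (t *: h)) v - 'd (w k) (p t) v.
  have linD : scalar D.
    by apply: scalar_sub => c u v; exact: linearP.
  rewrite -/(D (t *: h)); apply: (le_trans (scalar_row_bound _ linD)).
  apply: le_trans (_ : `|h| * (e / 2) <= _); last by rewrite mulrC.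
  apply: ler_pM => //; first exact: sumr_ge0.
  apply: le_trans (ltW Hs); apply: ler_sum => j _.
  by rewrite /D (deriveE _ (wd _ _ Us)) (deriveE _ (wd _ _ (KU _ Kp))).
- apply: (within_continuousB (within_continuousB Acb Aca)).
  apply: within_continuousM; first by apply: continuous_subspaceT => s; exact: cvg_id.
  by apply: within_continuous_line => t t01; exact/wcont/inB.
- by apply: continuous_subspaceT; exact: cl.
Qed.

(** * Charts and differentials of maps *)

Lemma smooth_on_differentiable (R : realType) (V W : normedModType R)
    (U : set V) (f : V -> W) (x : V) :
  smooth_on U f -> U x -> differentiable f x.
Proof. by move=> /(_ 1)[df _]; exact: df. Qed.

Lemma smooth_on_derive_continuous (R : realType) (V W : normedModType R)
    (U : set V) (f : V -> W) (x v : V) :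
  smooth_on U f -> U x -> {for x, continuous ('D_v f)}.
Proof. by move=> /(_ 1)[_ /(_ v) cf] Ux; apply: cf; rewrite inE. Qed.

Lemma diff_val_app (R : realType) (V W : normedModType R) (f df : V -> W) (x v : V) :
  is_diff x f df -> 'd f x v = df v.
Proof. by move=> [_ ->]. Qed.

Section charts.
Variables (R : realType) (n : nat) (X : topologicalType) (c : chart R n X).

Lemma chart_invK x : chart_dom c x -> chart_inv c (c x) = x.
Proof. by move=> cx; apply: chart_mapK; rewrite inE. Qed.

Lemma chart_img_inv z : chart_img c z ->
  chart_dom c (chart_inv c z) /\ c (chart_inv c z) = z.
Proof. by move=> [x cx <-]; rewrite chart_invK. Qed.

Lemma chart_img_map x : chart_dom c x -> chart_img c (c x).
Proof. by exists x. Qed.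

Lemma chart_img_nbhs z : chart_img c z -> \forall y \near z, chart_img c y.
Proof. by move=> cz; apply: open_nbhs_nbhs; split=> //; exact: chart_img_open. Qed.

Lemma chart_dom_nbhs x : chart_dom c x -> \forall y \near x, chart_dom c y.
Proof. by move=> cx; apply: open_nbhs_nbhs; split=> //; exact: chart_dom_open. Qed.

Lemma chart_inv_continuous z : chart_img c z -> {for z, continuous (chart_inv c)}.
Proof. by move=> cz; apply: chart_inv_cont; rewrite inE. Qed.

Lemma chart_continuous x : chart_dom c x -> {for x, continuous c}.
Proof. by move=> cx; apply: chart_map_cont; rewrite inE. Qed.

End charts.

Lemma transition_differentiable (R : realType) n (M : manifold R n)
    (c d : chart R n M) (x : M) : atlas c -> atlas d ->
  chart_dom c x -> chart_dom d x -> differentiable (d \o chart_inv c) (c x).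
Proof.
move=> ac ad cx dx; apply: (smooth_on_differentiable (atlas_compat ac ad)).
by exists x.
Qed.

(** The selected chart at [phi z] defines tangent vectors there, but computations
    happen in an arbitrary chart [d] of the atlas; this is the chain rule that
    moves from one to the other.  It covers curves ([V = R]) and maps read
    through a chart. *)
Lemma is_diff_chart_at (R : realType) n (V : normedModType R) (M : manifold R n)
    (phi : V -> M) (z : V) (d : chart R n M) :
  atlas d -> chart_dom d (phi z) -> {for z, continuous phi} ->
  differentiable (d \o phi) z ->
  is_diff z (chart_at (phi z) \o phi)
    (fun v => vec_of d (phi z) ('d (d \o phi) z v)).
Proof.
move=> ad dz cphi ddphi.
pose e := chart_at (phi z).
have ez : chart_dom e (phi z) by exact: chart_at_dom.
have dt := transition_differentiable ad (chart_at_atlas (phi z)) dz ez.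
have H : is_diff z ((e \o chart_inv d) \o (d \o phi))
    ('d (e \o chart_inv d) (d (phi z)) \o 'd (d \o phi) z).
  exact: (is_diff_comp (differentiableP ddphi) (differentiableP dt)).
apply: near_eq_is_diff H.
have near_dom : \forall y \near z, chart_dom d (phi y) := cphi _ (chart_dom_nbhs dz).
by apply: filterS near_dom => y /= dy; rewrite chart_invK.
Qed.

(** The selected chart is the one that identifies the tangent space with
    coordinates, hence it acts as the identity there. *)
Lemma vec_of_chart_at (R : realType) n (M : manifold R n) (x : M) (v : 'rV[R]_n) :
  vec_of (chart_at x) x v = v.
Proof.
rewrite /vec_of; set c := chart_at x.
have cx : chart_dom c x by exact: chart_at_dom.
have H : is_diff (c x) (c \o chart_inv c) id.
  apply: near_eq_is_diff (is_diff_id _).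
  apply: filterS (chart_img_nbhs (chart_img_map cx)) => z cz /=.
  by rewrite (chart_img_inv cz).2.
exact: (diff_val_app v H).
Qed.

Lemma velocity_chart (R : realType) n (M : manifold R n) (s : R -> M) (t : R)
    (d : chart R n M) :
  atlas d -> chart_dom d (s t) -> {for t, continuous s} ->
  differentiable (d \o s) t ->
  velocity s t = vec_of d (s t) ('D_1 (d \o s) t).
Proof.
move=> ad dt cs ds; have H := is_diff_chart_at ad dt cs ds.
have [dvel _] := H.
rewrite /velocity (deriveE _ dvel) (deriveE _ ds).
exact: (diff_val_app (1 : R) H).
Qed.

Lemma smooth_map_differentiable (R : realType) m n (M : manifold R m)
    (N : manifold R n) (f : M -> N) (c : chart R m M) (d : chart R n N) (x : M) :
  smooth_map f -> atlas c -> atlas d -> chart_dom c x -> chart_dom d (f x) ->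
  differentiable (d \o f \o chart_inv c) (c x).
Proof.
move=> [_ sf] ac ad cx dx; apply: (smooth_on_differentiable (sf c d ac ad)).
by exists x.
Qed.

(** Differentials of maps are matrices of partial derivatives in any charts of
    the atlases, not only in the selected ones. *)
Lemma mdiff_vec_of (R : realType) m n (M : manifold R m)
    (N : manifold R n) (f : M -> N) (c : chart R m M) (d : chart R n N) (x : M)
    (v : 'rV[R]_m) :
  smooth_map f -> atlas c -> atlas d -> chart_dom c x -> chart_dom d (f x) ->
  mdiff f x (vec_of c x v) = vec_of d (f x) ('d (d \o f \o chart_inv c) (c x) v).
Proof.
move=> sf ac ad cx dx; have xE := chart_invK cx.
have invc := chart_inv_continuous (chart_img_map cx).
have := @is_diff_chart_at _ _ _ N (f \o chart_inv c) (c x) d ad.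
rewrite /= xE => /(_ dx) H1.
have cfc : {for c x, continuous (f \o chart_inv c)}.
  by apply: continuous_comp => //; exact: sf.1.
have {}H1 := H1 cfc (smooth_map_differentiable sf ac ad cx dx).
pose e := chart_at x; pose e' := chart_at (f x).
have ex : chart_dom e x by exact: chart_at_dom.
have H2 : is_diff (c x) ((e' \o f \o chart_inv e) \o (e \o chart_inv c))
    ('d (e' \o f \o chart_inv e) (e x) \o 'd (e \o chart_inv c) (c x)).
  have d1 := transition_differentiable ac (chart_at_atlas x) cx ex.
  have d2 := smooth_map_differentiable sf (chart_at_atlas x) (chart_at_atlas (f x))
    ex (chart_at_dom (f x)).
  have exE : e x = (e \o chart_inv c) (c x) by rewrite /= xE.
  rewrite exE in d2 *.
  exact: (is_diff_comp (differentiableP d1) (differentiableP d2)).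
have H3 : is_diff (c x) (e' \o (f \o chart_inv c))
    ('d (e' \o f \o chart_inv e) (e x) \o 'd (e \o chart_inv c) (c x)).
  apply: near_eq_is_diff H2.
  have near_dom : \forall y \near c x, chart_dom e (chart_inv c y).
    by apply: invc; rewrite xE; exact: chart_dom_nbhs.
  by apply: filterS near_dom => y /= dy; rewrite chart_invK.
exact: etrans (esym (diff_val_app v H3)) (diff_val_app v H1).
Qed.

(** * The metric in a chart *)

Lemma continuous_at_sum (R : realType) (T : topologicalType) m
    (f : 'I_m -> T -> R) (x : T) :
  (forall i, {for x, continuous (f i)}) ->
  {for x, continuous (fun y => \sum_i f i y)}.
Proof.
by move=> cf; apply: cvg_big => [|i _]; [exact: add_continuous|exact: cf].
Qed.

Lemma row_unit_sphere_compact (R : realType) n :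
  compact [set v : 'rV[R]_n | `|v| = 1].
Proof.
apply: bounded_closed_compact.
  by exists 1; split; [exact: num_real|move=> C C1 v /= ->; exact: ltW].
have -> : [set v : 'rV[R]_n | `|v| = 1] = (fun v => `|v|) @^-1` [set 1] by [].
apply: closed_comp; first by move=> v _; exact: norm_continuous.
apply: compact_closed; [exact: Rhausdorff|exact: compact_set1].
Qed.

(** The minimum on the compact unit sphere; the sphere is empty in dimension 0,
    where every constant works. *)
Lemma quad_form_lower_bound (R : realType) n (q : 'rV[R]_n -> 'rV[R]_n -> R) :
  (forall v, scalar (q ^~ v)) -> (forall u, scalar (q u)) ->
  (forall v, v != 0 -> 0 < q v v) ->
  exists2 mu, 0 < mu & forall v, mu * `|v| ^+ 2 <= q v v.
Proof.
move=> ql qr qpos.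
have qZ c v : q (c *: v) (c *: v) = c ^+ 2 * q v v.
  have El u w : q (c *: u) w = c * q u w.
    pose f : {scalar 'rV[R]_n} := HB.pack (q ^~ w) (GRing.isLinear.Build _ _ _ _ _ (ql w)).
    exact: (linearZ_LR f c u).
  have Er u w : q u (c *: w) = c * q u w.
    pose f : {scalar 'rV[R]_n} := HB.pack (q u) (GRing.isLinear.Build _ _ _ _ _ (qr u)).
    exact: (linearZ_LR f c w).
  by rewrite El Er mulrA expr2.
have q0 : q 0 0 = 0 by have := qZ 0 0; rewrite scale0r expr0n mul0r.
have cq : continuous (fun v => q v v).
  have -> : (fun v => q v v) =
      (fun v => \sum_i \sum_j v 0 i * (v 0 j * q (delta_mx 0 i) (delta_mx 0 j))).
    apply/funext => v; rewrite (scalar_row_sum v (ql v)); apply: eq_bigr => i _.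
    by rewrite (scalar_row_sum v (qr _)) mulr_sumr.
  move=> v; apply: continuous_at_sum => i; apply: continuous_at_sum => j.
  have cc k : {for v, continuous (fun v : 'rV[R]_n => v 0 k)}.
    exact: coord_continuous.
  exact: (cvgM (cc i) (cvgM (cc j) (cvg_cst _))).
have [[v0 v01]|S0] := pselect (exists v : 'rV[R]_n, `|v| = 1).
  have [|||v1 v11 minv] := @EVT_min_rV R n (fun v => q v v) [set v : 'rV[R]_n | `|v| = 1].
  - by exists v0.
  - exact: row_unit_sphere_compact.
  - exact: continuous_subspaceT.
  rewrite inE /= in v11.
  have v1n0 : v1 != 0 by rewrite -normr_gt0 v11.
  exists (q v1 v1); first exact: qpos.
  move=> v; have [->|vn0] := eqVneq v 0.
    by rewrite normr0 expr0n /= mulr0 q0.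
  have nv0 : 0 < `|v| by rewrite normr_gt0.
  have := minv (`|v|^-1 *: v); rewrite inE /= normrZ normrV ?unitf_gt0// normr_id.
  rewrite mulVf ?gt_eqF// qZ => /(_ erefl).
  by rewrite exprVn ler_pdivlMl ?exprn_gt0// mulrC.
exists 1 => // v; have [->|vn0] := eqVneq v 0.
  by rewrite normr0 expr0n /= mulr0 q0.
exfalso; apply: S0; exists (`|v|^-1 *: v).
by rewrite normrZ normrV ?unitf_gt0 ?normr_gt0// normr_id mulVf ?normr_eq0.
Qed.

(** Pointwise continuity of the coefficients is enough: a small change of the
    finitely many entries moves the form by at most half of its lower bound. *)
Lemma quad_form_locally_bounded_below (R : realType) n
    (q : 'rV[R]_n -> 'rV[R]_n -> 'rV[R]_n -> R) (z0 : 'rV[R]_n) :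
  (forall z v, scalar (q z ^~ v)) -> (forall z u, scalar (q z u)) ->
  (forall u v, {for z0, continuous (fun z => q z u v)}) ->
  (forall v, v != 0 -> 0 < q z0 v v) ->
  exists2 m, 0 < m &
    \forall z \near z0, forall v, m * `|v| <= Num.sqrt (q z v v).
Proof.
move=> ql qr qc qpos.
have [mu mu0 Hmu] := quad_form_lower_bound (ql z0) (qr z0) qpos.
pose D z u v := q z u v - q z0 u v.
have Dl z v : scalar (D z ^~ v) := scalar_sub (ql z v) (ql z0 v).
have Dr z u : scalar (D z u) := scalar_sub (qr z u) (qr z0 u).
have mu20 : 0 < mu / 2 by rewrite divr_gt0.
exists (Num.sqrt (mu / 2)); first by rewrite sqrtr_gt0.
have Dsmall : \forall z \near z0,
    \sum_i \sum_j `|D z (delta_mx 0 i) (delta_mx 0 j)| < mu / 2.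
  have H : (\sum_i \sum_j `|D z (delta_mx 0 i) (delta_mx 0 j)|) @[z --> z0] -->
     \sum_i \sum_j `|D z0 (delta_mx 0 i) (delta_mx 0 j)|.
    apply: continuous_at_sum => i; apply: continuous_at_sum => j.
    have cD : {for z0, continuous (fun z => D z (delta_mx 0 i) (delta_mx 0 j))}.
      apply: (@continuousB _ _ _ (fun z => q z _ _) (fun=> q z0 _ _)); first exact: qc.
      exact: cst_continuous.
    exact: (cvg_norm cD).
  rewrite [X in _ --> X]big1 in H; last first.
    by move=> i _; rewrite big1// => j _; rewrite /D subrr normr0.
  move/cvgrPdist_lt : H => /(_ _ mu20); apply: filterS => z.
  by rewrite sub0r normrN; apply: le_lt_trans; exact: ler_norm.
apply: filterS Dsmall => z Dz v.
have Dv : `|D z v v| <= `|v| ^+ 2 * (mu / 2).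
  apply: (le_trans (scalar_row_bound v (Dl z v))).
  rewrite expr2 -mulrA ler_wpM2l//.
  apply: le_trans (_ : `|v| * \sum_i \sum_j `|D z (delta_mx 0 i) (delta_mx 0 j)| <= _).
    rewrite mulr_sumr; apply: ler_sum => i _; exact: scalar_row_bound.
  by rewrite ler_wpM2l// ltW.
have -> : Num.sqrt (mu / 2) * `|v| = Num.sqrt (mu / 2 * `|v| ^+ 2).
  by rewrite (sqrtrM _ (ltW mu20)) sqrtr_sqr normr_id.
rewrite ler_wsqrtr//.
have := Hmu v; move: Dv; rewrite ler_norml /D => /andP[+ _].
move: (q z v v) (q z0 v v) => a b Dv Hv.
have -> : mu / 2 * `|v| ^+ 2 = mu * `|v| ^+ 2 - `|v| ^+ 2 * (mu / 2) by field.
lra.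
Qed.

(** The transition map in the other direction gives a left inverse. *)
Lemma vec_of_inj0 (R : realType) n (M : manifold R n) (c : chart R n M)
    (x : M) (v : 'rV[R]_n) :
  atlas c -> chart_dom c x -> vec_of c x v = 0 -> v = 0.
Proof.
move=> ac cx; rewrite /vec_of; set e := chart_at x => vE.
have ex : chart_dom e x by exact: chart_at_dom.
have d1 := transition_differentiable ac (chart_at_atlas x) cx ex.
have d2 := transition_differentiable (chart_at_atlas x) ac ex cx.
have exE : chart_at x x = (e \o chart_inv c) (c x) by rewrite /= chart_invK.
rewrite exE in d2.
have H := is_diff_comp (differentiableP d1) (differentiableP d2).
have H2 : is_diff (c x) id
    ('d (c \o chart_inv e) ((e \o chart_inv c) (c x)) \o 'd (e \o chart_inv c) (c x)).
  apply: near_eq_is_diff H.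
  have near_dom : \forall y \near c x, chart_dom e (chart_inv c y).
    apply: chart_inv_continuous; first exact: chart_img_map.
    by rewrite chart_invK//; exact: chart_dom_nbhs.
  move: (chart_img_nbhs (chart_img_map cx)); apply: filterS2 near_dom => y ey cy /=.
  by rewrite (chart_invK ey) (chart_img_inv cy).2.
have := etrans (esym (diff_val_app v H2)) (diff_val_app v (is_diff_id _)) => /= <-.
pose L := 'd (c \o chart_inv e) ((e \o chart_inv c) (c x)).
exact: (etrans (congr1 L vE) (linear0 L)).
Qed.

Section metric_in_chart.
Variables (R : realType) (n : nat) (M : manifold R n) (g : riemannian_metric M).
Variables (d : chart R n M) (ad : atlas d).

Definition metric_coef (z u v : 'rV[R]_n) : R :=
  g (chart_inv d z) (vec_of d (chart_inv d z) u) (vec_of d (chart_inv d z) v).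

Lemma metric_coefl z v : scalar (metric_coef z ^~ v).
Proof.
move=> c u w; rewrite /metric_coef.
have -> : vec_of d (chart_inv d z) (c *: u + w) =
  c *: vec_of d (chart_inv d z) u + vec_of d (chart_inv d z) w by exact: linearP.
exact: metric_linear.
Qed.

Lemma metric_coefC z u v : metric_coef z u v = metric_coef z v u.
Proof. by rewrite /metric_coef Defs.metric_sym. Qed.

Lemma metric_coefr z u : scalar (metric_coef z u).
Proof. by move=> c v w; rewrite !(metric_coefC _ u); exact: metric_coefl. Qed.

Lemma metric_coef_gt0 z v : chart_img d z -> v != 0 -> 0 < metric_coef z v v.
Proof.
move=> dz vn0; apply: metric_pos; apply: contra_neq vn0 => /vec_of_inj0; apply=> //.
exact: (chart_img_inv dz).1.
Qed.

Lemma metric_coef_continuous z u v : chart_img d z ->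
  {for z, continuous (fun z => metric_coef z u v)}.
Proof. by move=> dz; have := metric_smooth g ad u v 0; apply; rewrite inE. Qed.

Lemma metric_coef_sum z v : metric_coef z v v =
  \sum_i \sum_j v 0 i * (v 0 j * metric_coef z (delta_mx 0 i) (delta_mx 0 j)).
Proof.
rewrite (scalar_row_sum v (metric_coefl z v)); apply: eq_bigr => i _.
by rewrite (scalar_row_sum v (metric_coefr _ _)) mulr_sumr.
Qed.

Lemma metric_coef_lower_bound z0 : chart_img d z0 ->
  exists m, exists2 r, 0 < m /\ 0 < r & forall z, `|z - z0| < r ->
    chart_img d z /\ forall v, m * `|v| <= Num.sqrt (metric_coef z v v).
Proof.
move=> dz0.
have [m m0 Hm] := quad_form_locally_bounded_below metric_coefl metric_coefr
  (fun u v => @metric_coef_continuous z0 u v dz0) (fun v => @metric_coef_gt0 z0 v dz0).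
have [r r0 Hr] := (near_normP _ _).1 (filterI (chart_img_nbhs dz0) Hm).
by exists m, r.
Qed.

End metric_in_chart.

(** * Speed of smooth segments *)

(** Real induction from 1 down to 0.  It goes backwards because a path whose
    endpoint is known to lie in a chart has to be followed back to its start. *)
Lemma real_induction_down (R : realType) (P : R -> Prop) :
  P 1 ->
  (forall t, 0 <= t < 1 -> (forall u, t < u <= 1 -> P u) -> P t) ->
  (forall t, 0 < t <= 1 -> (forall u, t <= u <= 1 -> P u) ->
    exists2 e, 0 < e & forall u, 0 <= u -> t - e < u < t -> P u) ->
  P 0.
Proof.
move=> P1 Plim Popen.
pose S := [set t : R | 0 <= t <= 1 /\ forall u, t <= u <= 1 -> P u].
have S1 : S 1.
  by split; [rewrite lexx ler01|move=> u u1; have -> : u = 1 by apply/eqP; rewrite eq_le andbC].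
have lbS : lbound S 0 by move=> t [/andP[]].
have hS : has_inf S by split; [exists 1|exists 0].
pose T := inf S.
have T0 : 0 <= T by apply: lb_le_inf => //; exists 1.
have T1 : T <= 1 by apply: ge_inf => //; exists 0.
have gtT u : T < u <= 1 -> P u.
  move=> /andP[Tu u1]; have uT : 0 < u - T by rewrite subr_gt0.
  have [t [_ Pt] tu] := inf_adherent uT hS.
  by apply: Pt; rewrite u1 andbT ltW//; move: tu; rewrite -/T; lra.
have PT : P T.
  have [T1'|T1'] := ltP T 1; first by apply: Plim => //; rewrite T0.
  by have -> : T = 1 by apply/eqP; rewrite eq_le T1.
have geT u : T <= u <= 1 -> P u.
  by rewrite le_eqVlt => /andP[/orP[/eqP <-//|Tu] u1]; apply: gtT; rewrite Tu.
have [Tpos|Tneg] := ltP 0 T; last by apply: geT; rewrite Tneg ler01.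
have [|e e0 He] := Popen T _ geT; first by rewrite Tpos.
pose t := Num.max 0 (T - e / 2).
have tT : t < T by rewrite gt_max Tpos /=; lra.
have : T <= t.
  apply: ge_inf; first by exists 0.
  split; first by rewrite le_max lexx /= (le_trans (ltW tT)).
  move=> u /andP[tu u1]; have [uT|Tu] := ltP u T; last by apply: geT; rewrite Tu.
  move: tu; rewrite ge_max => /andP[u0 Tu]; apply: He => //; rewrite uT andbT; lra.
by rewrite leNgt tT.
Qed.

Section segment_speed.
Variables (R : realType) (n : nat) (M : manifold R n) (g : riemannian_metric M).
Variables (s : R -> M) (U : set R).
Hypotheses (oU : open U) (cs : {in U, continuous s})
  (ss : forall c, atlas c -> smooth_on (U `&` s @^-1` chart_dom c) (c \o s)).

Definition speed (t : R) : R := Num.sqrt (g (s t) (velocity s t) (velocity s t)).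

Lemma segment_continuous t : U t -> {for t, continuous s}.
Proof. by move=> Ut; apply: cs; rewrite inE. Qed.

Lemma speed_chart (d : chart R n M) (t : R) : atlas d -> U t -> chart_dom d (s t) ->
  speed t = Num.sqrt (metric_coef g d (d (s t)) ('D_1 (d \o s) t) ('D_1 (d \o s) t)).
Proof.
move=> ad Ut dt; rewrite /speed /metric_coef (chart_invK dt).
rewrite (velocity_chart ad dt (segment_continuous Ut))//.
by apply: (smooth_on_differentiable (ss ad)).
Qed.

(** Continuity cannot be read off the definition, in which the chart used for
    the velocity jumps with the point; near a given parameter one fixed chart
    can be used for all points. *)
Lemma speed_continuous t : U t -> {for t, continuous speed}.
Proof.
move=> Ut; pose d := chart_at (s t); have ad : atlas d := chart_at_atlas _.
have dt : chart_dom d (s t) := chart_at_dom _.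
pose w u := 'D_1 (d \o s) u.
have near_dom : \forall u \near t, U u /\ chart_dom d (s u).
  apply: filterI; first exact: open_nbhs_nbhs.
  exact: (segment_continuous Ut (chart_dom_nbhs dt)).
have cw : {for t, continuous w}.
  by apply: (smooth_on_derive_continuous (ss ad)).
have ccoord i : {for t, continuous (fun u => w u 0 i)}.
  apply: (@continuous_comp _ _ _ w (fun m : 'rV[R]_n => m 0 i)); first exact: cw.
  exact: coord_continuous.
have cds : {for t, continuous (d \o s)}.
  by apply: differentiable_continuous; apply: (smooth_on_differentiable (ss ad)).
have dz := chart_img_map dt.
have cq i j : {for t, continuous
    (fun u => metric_coef g d (d (s u)) (delta_mx 0 i) (delta_mx 0 j))}.
  apply: (@continuous_comp _ _ _ (d \o s)
    (fun z => metric_coef g d z (delta_mx 0 i) (delta_mx 0 j))); first exact: cds.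
  exact: metric_coef_continuous.
pose f u := \sum_i \sum_j w u 0 i * (w u 0 j *
  metric_coef g d (d (s u)) (delta_mx 0 i) (delta_mx 0 j)).
have cf : {for t, continuous f}.
  apply: continuous_at_sum => i; apply: continuous_at_sum => j.
  exact: (cvgM (ccoord i) (cvgM (ccoord j) (cq i j))).
have csf : {for t, continuous (Num.sqrt \o f)}.
  apply: (@continuous_comp _ _ _ f (@Num.sqrt R)); first exact: cf.
  exact: sqrt_continuous.
have E u : U u /\ chart_dom d (s u) -> speed u = (Num.sqrt \o f) u.
  by move=> [Uu du]; rewrite (speed_chart ad Uu du) metric_coef_sum.
rewrite /prop_for /continuous_at (E t)//.
apply: cvg_trans csf; apply: near_eq_cvg.
by apply: filterS near_dom => u /E.
Qed.

End segment_speed.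

(** * The Riemannian distance controls coordinates *)

Lemma segment_length_ge0 (R : realType) n (M : manifold R n)
    (g : riemannian_metric M) (s : R -> M) : (0 <= segment_length g s)%E.
Proof. by apply: integral_ge0 => t _; rewrite lee_fin sqrtr_ge0. Qed.

Lemma curve_length_ge0 (R : realType) n (M : manifold R n)
    (g : riemannian_metric M) (p : seq (R -> M)) : (0 <= curve_length g p)%E.
Proof. by apply: sume_ge0 => s _; exact: segment_length_ge0. Qed.

Section segment_in_chart.
Variables (R : realType) (n : nat) (M : manifold R n) (g : riemannian_metric M).
Variables (d : chart R n M) (ad : atlas d) (z0 : 'rV[R]_n) (m r : R).
Hypothesis m0 : 0 < m.
Hypothesis lower : forall z, `|z - z0| < r ->
  chart_img d z /\ forall v, m * `|v| <= Num.sqrt (metric_coef g d z v v).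

(** Closedness in the whole manifold, where the Hausdorff property is needed: it
    is what prevents a path from leaving the chart without crossing the boundary
    of the ball. *)
Lemma closed_chart_ball (rho : R) : 0 < rho < r ->
  closed (chart_inv d @` [set z | `|z - z0| <= rho]).
Proof.
move=> /andP[rho0 rhor]; apply: compact_closed; first exact: mf_hausdorff.
have KE : [set z | `|z - z0| <= rho] = closed_ball z0 rho.
  by rewrite closed_ballE//; apply/seteqP; split=> z; rewrite /closed_ball_ /= distrC.
apply: continuous_compact.
  apply: continuous_in_subspaceT => z; rewrite inE /= => zrho.
  by apply: chart_inv_continuous; apply: (lower _).1; exact: le_lt_trans rhor.
rewrite KE; apply: bounded_closed_compact; last exact: closed_ball_closed.
rewrite -KE; exists (rho + `|z0|); split; first exact: num_real.
move=> C C1 z /= zrho; apply: ltW; apply: le_lt_trans C1.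
by rewrite -[z](subrK z0) (le_trans (ler_normD _ _))// lerD2r.
Qed.

(** Going back from [s 1], the coordinate displacement is at most the length run
    divided by [m], as long as the segment stays in the coordinate ball where
    the metric is at least [m ^ 2] times the square of the coordinate norm.
    That bound in turn keeps the segment inside the ball, and real induction
    closes the circle. *)
Lemma segment_start_close (s : R -> M) (L : R) : smooth_segment s ->
  segment_length g s = L%:E -> 0 <= L -> chart_dom d (s 1) ->
  `|d (s 1) - z0| + L / m < r ->
  chart_dom d (s 0) /\ `|d (s 0) - d (s 1)| <= L / m.
Proof.
move=> [U [oU IU cs ss]] sL L0 d1 d1r.
have UI (t : R) : 0 <= t <= 1 -> U t by move=> t01; apply: IU; rewrite /= in_itv.
have scont t : 0 <= t <= 1 -> {for t, continuous s}.
  by move=> t01; exact: (segment_continuous cs (UI _ t01)).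
have [t t01|l [l0 lc dl l1]] := @exists_antiderivative _ (speed g s).
  by apply: (speed_continuous oU cs ss); apply: UI; move: t01; rewrite in_itv.
have {}l1 : l 1 = L.
  by move: sL; rewrite /segment_length l1 => -[].
have l_mono (u t : R) : 0 <= u -> u <= t -> t <= 1 -> l u <= l t.
  move=> u0 ut t1.
  have := @ger0_derive1_le_cc _ l 0 1 _ _ lc; apply => //.
  - by move=> x /dl[].
  - move=> x x01; rewrite derive1E; have [_ ->] := dl _ x01; exact: sqrtr_ge0.
  - by rewrite in_itv /= u0 (le_trans ut).
  - by rewrite in_itv /= t1 (le_trans u0).
pose P t := chart_dom d (s t) /\ `|d (s t) - d (s 1)| <= (L - l t) / m.
suff : P 0 by rewrite /P l0 subr0.
(* A radius strictly between the reach of the segment and r, so that the closed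
   ball of radius rho lies in the image of the chart. *)
pose rho := (`|d (s 1) - z0| + L / m + r) / 2.
have rho_gt : `|d (s 1) - z0| + L / m < rho by rewrite /rho; lra.
have rho_lt : rho < r by rewrite /rho; lra.
have rho0 : 0 < rho.
  by apply: le_lt_trans rho_gt; rewrite addr_ge0// divr_ge0// ltW.
have Prho t : 0 <= t <= 1 -> P t -> `|d (s t) - z0| < rho.
  move=> /andP[t0 t1] [_ Pt]; apply: le_lt_trans rho_gt.
  apply: le_trans (ler_distD (d (s 1)) _ _) _; rewrite addrC lerD2l.
  apply: le_trans Pt _; rewrite ler_pM2r ?invr_gt0// lerBlDr lerDl -l0.
  exact: l_mono.
apply: real_induction_down.
- by rewrite /P subrr normr0 l1 subrr mul0r.
- move=> t /andP[t0 t1] Pt.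
  have t01 : 0 <= t <= 1 by rewrite t0 ltW.
  have near_right (A : set M) : nbhs (s t) A -> exists2 u, t < u <= 1 & A (s u).
    move=> nA; have /near_normP[e e0 He] : \forall u \near t, A (s u) := scont _ t01 _ nA.
    exists (Num.min 1 (t + e / 2)).
      by rewrite lt_min t1 /= ge_min lexx /= ltrDl divr_gt0.
    apply: He; rewrite ger0_norm.
      by rewrite ltrBlDr gt_min; apply/orP; right; lra.
    by rewrite subr_ge0 le_min ltW//= lerDl ltW// divr_gt0.
  (* s t is a limit of points of the closed set of the chart ball. *)
  have [z zrho zst] : (chart_inv d @` [set z | `|z - z0| <= rho]) (s t).
    apply: (closed_chart_ball _); first by rewrite rho0.
    move=> A /near_right[u ut Au]; exists (s u); split=> //.
    have u01 : 0 <= u <= 1.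
      by case/andP: ut => tu ->; rewrite andbT (le_trans t0)// ltW.
    have Pu := Pt _ ut; exists (d (s u)); first exact/ltW/Prho.
    by apply: chart_invK; exact: Pu.1.
  have dt : chart_dom d (s t).
    rewrite -zst; apply: (chart_img_inv _).1.
    by apply: (lower _).1; exact: le_lt_trans rho_lt.
  split=> //; apply/ler_addgt0Pr => e e0.
  have [u ut [du ue]] := near_right _ (filterI (chart_dom_nbhs dt)
    ((cvgrPdist_lt _ _).1 (chart_continuous dt) _ e0)).
  have [_ Pu] := Pt _ ut.
  apply: le_trans (ler_distD (d (s u)) _ _) _; rewrite addrC; apply: lerD; last exact: ltW.
  apply: le_trans Pu _; rewrite ler_pM2r ?invr_gt0// lerD2l lerN2.
  by case/andP: ut => tu u1; apply: l_mono => //; exact: ltW.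
- move=> t /andP[t0 t1] Pt.
  have t01 : 0 <= t <= 1 by rewrite t1 ltW.
  have [dt Ptt] : P t by apply: Pt; rewrite lexx.
  have dtr : `|d (s t) - z0| < r by apply: lt_trans rho_lt; apply: Prho.
  have near_dom : \forall u \near t, chart_dom d (s u) /\ `|d (s u) - z0| < r.
    apply: filterI; first exact: (scont _ t01 _ (chart_dom_nbhs dt)).
    have rr : 0 < r - `|d (s t) - z0| by rewrite subr_gt0.
    have near_st : \forall y \near s t, `|d y - z0| < r.
      apply: filterS ((cvgrPdist_lt _ _).1 (chart_continuous dt) _ rr) => y yt.
      have := ler_distD (d (s t)) (d y) z0; rewrite (distrC (d y) (d (s t))); lra.
    exact: (scont _ t01 _ near_st).
  have [e e0 He] := (near_normP _ _).1 near_dom.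
  exists e => // u u0 /andP[eu ut].
  have near_u x : u <= x <= t -> chart_dom d (s x) /\ `|d (s x) - z0| < r.
    by move=> /andP[ux xt]; apply: He; rewrite ler0_norm ?subr_le0//; lra.
  have [du dur] : chart_dom d (s u) /\ `|d (s u) - z0| < r.
    by apply: near_u; rewrite lexx ltW.
  split=> //.
  apply: le_trans (ler_distD (d (s t)) _ _) _.
  have -> : (L - l u) / m = (l t - l u) / m + (L - l t) / m by ring.
  rewrite lerD//.
  have lm : 0 <= (l t - l u) / m.
    apply: divr_ge0; last exact: ltW.
    by rewrite subr_ge0; apply: l_mono => //; exact: ltW.
  (* The norm is the maximum of the coordinates, each of which has derivative at
     most speed / m. *)
  apply: norm_row_le => // j; rewrite !mxE -normrN opprB.
  have dds x : u <= x <= t -> differentiable (d \o s) x.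
    move=> xut; apply: (smooth_on_differentiable (ss d ad)).
    have [dx _] := near_u _ xut; split=> //; apply: UI.
    by case/andP: xut => ux xt; rewrite (le_trans u0)//= (le_trans xt).
  have oo_cc x : x \in `]u, t[ -> u <= x <= t.
    by rewrite in_itv /= => /andP[ux xt]; rewrite !ltW.
  have -> : (l t - l u) / m = m^-1 * l t - m^-1 * l u by ring.
  pose f (x : R) := d (s x) 0 j; pose k (x : R) := m^-1 * l x.
  pose f' (x : R) := ('D_1 (d \o s) x) 0 j; pose k' (x : R) := m^-1 * speed g s x.
  rewrite -/(f t) -/(f u) -/(k t) -/(k u).
  have df x : x \in `]u, t[ -> is_derive x 1 f (f' x).
    move=> /oo_cc xut; have dx : derivable (d \o s) x 1 by apply/derivable1_diffP/dds.
    rewrite /f' (derive_mx dx) mxE; apply: derivableP.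
    exact: ((derivable_mxP _ _ _).1 dx 0 j).
  have dk x : x \in `]u, t[ -> is_derive x 1 k (k' x).
    move=> xut; have x01 : x \in `]0, 1[.
      move: xut; rewrite !in_itv /= => /andP[ux xt].
      by rewrite (le_lt_trans u0)//= (lt_le_trans xt).
    exact: (@is_deriveZ _ _ _ _ m^-1 _ _ _ (dl _ x01)).
  have fk x : x \in `]u, t[ -> `|f' x| <= k' x.
    move=> /oo_cc xut; have [dx xr] := near_u _ xut.
    apply: le_trans (norm_row_coord _ _) _; rewrite ler_pdivlMl//.
    have Ux : U x by apply: UI; case/andP: xut => ux xt; rewrite (le_trans u0)//= (le_trans xt).
    rewrite (speed_chart g cs ss ad Ux dx); exact: (lower xr).2.
  have cf : {within `[u, t], continuous f}.
    apply: continuous_in_subspaceT => x; rewrite inE /= in_itv /= => /dds dx.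
    apply: (@continuous_comp _ _ _ (d \o s) (fun v : 'rV[R]_n => v 0 j)).
      exact: differentiable_continuous.
    exact: coord_continuous.
  have ck : {within `[u, t], continuous k}.
    have lc' : {within `[u, t], continuous l}.
      apply: continuous_subspaceW lc; apply: subset_itvScc; rewrite bnd_simp//.
    move=> x; apply: (@continuousM _ (subspace `[u, t]) (fun=> m^-1) l); last exact: lc'.
    exact: cst_continuous.
  exact: (derive_le_increment (ltW ut) df dk fk cf ck).
Qed.

Lemma path_start_close (p : seq (R -> M)) (x y : M) (L : R) :
  piecewise_smooth x p y -> (curve_length g p <= L%:E)%E -> chart_dom d y ->
  `|d y - z0| + L / m < r ->
  chart_dom d x /\ `|d x - d y| <= L / m.
Proof.
elim: p x L => [|s p IH] x L /=.
  move=> ->; rewrite /curve_length big_nil lee_fin => L0 dy _.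
  by rewrite subrr normr0 divr_ge0// ltW.
move=> [ss s0 sp]; rewrite /curve_length big_cons -/(curve_length g p) => sL dy yr.
have sge := segment_length_ge0 g s; have pge := curve_length_ge0 g p.
move: sge sL; case sE : (segment_length g s) => [L1| |] //; last first.
  by move=> _; rewrite addye// gt_eqF// (lt_le_trans _ pge)// ltNy0.
rewrite lee_fin => L10 sL.
have pL : (curve_length g p <= (L - L1)%:E)%E by rewrite EFinB leeBrDr// addeC.
have L1L : L1 <= L.
  by have := le_trans pge pL; rewrite lee_fin subr_ge0.
have mm : L / m = L1 / m + (L - L1) / m by ring.
have L1m : 0 <= L1 / m by rewrite divr_ge0// ltW.
have [|ds1 s1y] := IH (s 1) (L - L1) sp pL dy; first by move: yr; rewrite mm; lra.
have [|ds0 s0s1] := segment_start_close ss sE L10 ds1.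
  have := ler_distD (d y) (d (s 1)) z0; lra.
rewrite -s0; split=> //; have := ler_distD (d (s 1)) (d (s 0)) (d y); lra.
Qed.

End segment_in_chart.

(** Points at small Riemannian distance of a point of a small coordinate ball lie
    in the chart and have close coordinates, uniformly over the ball.  The
    distance is an infimum over all paths, including those leaving the chart:
    the latter are too long. *)
Lemma riemannian_dist_chart (R : realType) n (M : manifold R n)
    (g : riemannian_metric M) (d : chart R n M) (z0 : 'rV[R]_n) :
  atlas d -> chart_img d z0 ->
  exists2 r, 0 < r & forall e, 0 < e -> exists2 delta, 0 < delta &
    forall x y, chart_dom d y -> `|d y - z0| < r ->
      (riemannian_dist g x y < delta%:E)%E ->
      chart_dom d x /\ `|d x - d y| < e.
Proof.
move=> ad dz0; have [m [r [m0 r0] lower]] := metric_coef_lower_bound g ad dz0.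
exists (r / 2); first by rewrite divr_gt0.
move=> e e0; exists (m * Num.min e (r / 2)).
  by rewrite mulr_gt0// lt_min e0 divr_gt0.
move=> x y dy yr /ereal_inf_lt[_ [p sp <-]] pd.
have pge := curve_length_ge0 g p.
have [L pL] : exists L, curve_length g p = L%:E.
  move: pge pd; case: (curve_length g p) => [L| |] //; by exists L.
move: pd; rewrite pL lte_fin -ltr_pdivrMl// lt_min mulrC => /andP[Le Lr].
have [||dx xy] := path_start_close ad m0 lower sp (L := L) _ dy.
- by rewrite pL.
- lra.
- by split=> //; exact: le_lt_trans Le.
Qed.

(** * Limits of derivatives, and forms in charts *)

(** Derivatives converging uniformly and functions converging pointwise: the
    limit has the limit derivative.  The derivative [A] at 0 is assumed to exist,
    and one side of 0 suffices to compute it. *)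
Lemma derivative_of_uniform_limit (R : realType) (f_ f'_ : nat -> R -> R)
    (f h : R -> R) (A delta : R) (N : nat) :
  0 < delta ->
  (forall i t, (N <= i)%N -> 0 <= t <= delta -> is_derive t 1 (f_ i) (f'_ i t)) ->
  (forall e, 0 < e -> exists N', forall i t, (N' <= i)%N -> 0 <= t <= delta ->
    `|f'_ i t - h t| <= e) ->
  (forall t, 0 <= t <= delta -> f_ i t @[i --> \oo] --> f t) ->
  {for 0, continuous h} -> is_derive (0 : R) 1 f A -> A = h 0.
Proof.
move=> delta0 df unif ptw ch dfA.
apply/eqP; rewrite -subr_eq0 -normr_le0; apply/ler_addgt0Pr => e e0.
rewrite add0r; have e30 : 0 < e / 3 by rewrite divr_gt0.
have [d1 d10 hd1] := (near_normP _ _).1 ((cvgrPdist_lt _ _).1 ch _ e30).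
have diff_f : differentiable f 0 by apply/derivable1_diffP; case: dfA.
have df0 u : 'd f 0 u = u * A.
  have [df1 <-] := dfA; by rewrite (diff1E diff_f) derive1E.
have [_ diff_eps] := (is_diff_epsP f _ 0).1 (differentiableP diff_f).
have [d2 d20 hd2] := (near_normP _ _).1 (diff_eps _ e30).
pose s := Num.min delta (Num.min d1 d2) / 2.
have s0 : 0 < s by rewrite divr_gt0// !lt_min delta0 d10 d20.
have [sdelta sd1 sd2] : [/\ s < delta, s < d1 & s < d2].
  have lt2 (a : R) : 0 < a -> a / 2 < a by lra.
  have m0 : 0 < Num.min delta (Num.min d1 d2) by rewrite !lt_min delta0 d10 d20.
  have := lt2 _ m0; rewrite -/s !lt_min => /and3P[? ? ?]; by split.
have hs t : 0 <= t <= s -> `|h t - h 0| <= e / 3.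
  move=> /andP[t0 ts]; rewrite distrC ltW//; apply: hd1.
  by rewrite subr0 ger0_norm// (le_lt_trans ts).
have [N' HN'] := unif _ e30.
have inc i : (maxn N N' <= i)%N -> `|f_ i s - f_ i 0 - s * h 0| <= s * (e / 3 + e / 3).
  rewrite geq_max => /andP[Ni N'i].
  have in_cc (t : R) : t \in `]0, s[ -> (0 <= t <= s) /\ (0 <= t <= delta).
    rewrite in_itv /= => /andP[t0 ts]; split; rewrite !ltW//.
    exact: lt_trans sdelta.
  pose k (c t : R) := t * c.
  have dk c (t : R) : is_derive t 1 (k c) c := is_derive_mulrr c t.
  have ck c : {within `[0, s], continuous (k c)}.
    by apply: continuous_subspaceT => t; exact: mulrr_continuous.
  have dg (t : R) : t \in `]0, s[ -> is_derive t 1 (f_ i - k (h 0)) (f'_ i t - h 0).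
    move=> /in_cc[_ td]; exact: (is_deriveB (df i t Ni td) (dk _ _)).
  have bd (t : R) : t \in `]0, s[ -> `|f'_ i t - h 0| <= e / 3 + e / 3.
    move=> /in_cc[ts td]; apply: le_trans (ler_distD (h t) _ _) _.
    by apply: lerD; [exact: HN'|exact: hs].
  have cf : {within `[0, s], continuous (f_ i)}.
    apply: continuous_in_subspaceT => t; rewrite inE /= in_itv /= => /andP[t0 ts].
    apply: differentiable_continuous; apply/derivable1_diffP.
    by have [] := df i t Ni; rewrite ?t0 ?(le_trans ts) ?ltW.
  have := derive_le_increment (ltW s0) dg (fun t _ => dk (e / 3 + e / 3) t) bd
    (within_continuousB cf (ck (h 0))) (ck _).
  rewrite /k !fctE !mul0r !subr0; congr (`|_| <= _); ring.
(* The estimate for f_ i on [0, s] passes to the limit in i. *)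
have lim : `|f s - f 0 - s * h 0| <= s * (e / 3 + e / 3).
  have cvg : `|f_ i s - f_ i 0 - s * h 0| @[i --> \oo] --> `|f s - f 0 - s * h 0|.
    apply: cvg_norm; apply: cvgB; last exact: cvg_cst.
    apply: cvgB; apply: ptw; first by rewrite !ltW.
    by rewrite lexx ltW.
  apply: (cvgr_to_le cvg); exists (maxn N N') => // i /= ; exact: inc.
have := hd2 s; rewrite df0 !subr0 (gtr0_norm s0) => /(_ sd2) Hs.
have : `|A - h 0| * s <= e * s.
  rewrite -{1}(gtr0_norm s0) -normrM.
  have -> : (A - h 0) * s = (f s - f 0 - s * h 0) - (f s - f 0 - s * A) by ring.
  apply: le_trans (ler_normB _ _) _; apply: le_trans (lerD lim Hs) _.
  by rewrite le_eqVlt; apply/orP; left; apply/eqP; field.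
by rewrite ler_pM2r.
Qed.

Section forms.
Variables (R : realType) (n : nat) (M : manifold R n).

Lemma vec_of_linear (c : chart R n M) (x : M) : linear (vec_of c x).
Proof. by move=> k u v; exact: linearP. Qed.

Lemma mdiff_linear (f : M -> M) (x : M) : linear (mdiff f x).
Proof. by move=> k u v; exact: linearP. Qed.

Lemma coef_linear (a : cofield M) (c : chart R n M) (z : 'rV[R]_n) :
  (forall x, scalar (a x)) -> scalar (coef a c ^~ z).
Proof. by move=> la k u v; rewrite /coef vec_of_linear; exact: la. Qed.

Lemma pullback_linear (f : M -> M) (a : cofield M) :
  (forall x, scalar (a x)) -> forall x, scalar (@pullback _ _ _ _ _ f a x).
Proof. by move=> la x k u v; rewrite /pullback mdiff_linear; exact: la. Qed.

Lemma coef_chart_at (a : cofield M) (x : M) (v : 'rV[R]_n) :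
  coef a (chart_at x) v (chart_at x x) = a x v.
Proof. by rewrite /coef (chart_invK (chart_at_dom x)) vec_of_chart_at. Qed.

Lemma coef_pullback (f : M -> M) (a : cofield M) (c d : chart R n M)
    (v z : 'rV[R]_n) :
  smooth_map f -> atlas c -> atlas d -> chart_img c z ->
  chart_dom d (f (chart_inv c z)) ->
  coef (pullback f a) c v z =
    coef a d ('d (d \o f \o chart_inv c) z v) (d (f (chart_inv c z))).
Proof.
move=> sf ac ad cz dz; have [cx zE] := chart_img_inv cz.
rewrite /coef /pullback (mdiff_vec_of _ sf ac ad cx dz) zE.
by rewrite (chart_invK dz).
Qed.

Lemma closed_form_primitive (a : one_form M) (d : chart R n M) (y0 : 'rV[R]_n) :
  closed_form a -> atlas d -> chart_img d y0 ->
  exists2 r, 0 < r & exists F : 'rV[R]_n -> R, forall y, `|y - y0| < r ->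
    is_diff y F (coef a d ^~ y).
Proof.
move=> clo ad dy0.
have [r r0 Hr] := (near_normP _ _).1 (chart_img_nbhs dy0).
exists r => //; apply: closed_has_primitive.
- by move=> y; apply: coef_linear; exact: form_linear.
- by move=> v y /Hr; apply: (smooth_on_differentiable (form_smooth a ad v)).
- by move=> u v y /Hr; apply: (smooth_on_derive_continuous (form_smooth a ad v)).
- move=> u v y /Hr dy; apply/eqP; rewrite -subr_eq0; apply/eqP.
  exact: (clo d ad y dy u v).
Qed.

(** By homogeneity: [v / C] lies in the unit ball over which the covector norm is
    the supremum. *)
Lemma sup_norm_bound (g : riemannian_metric M) (a : cofield M) (e C : R)
    (x : M) (v : tangent x) :
  scalar (a x) -> (sup_norm g a <= e%:E)%E -> 0 < C -> g x v v <= C ^+ 2 ->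
  `|a x v| <= e * C.
Proof.
move=> la ae C0 gC.
have gl : scalar (fun u : tangent x => g x u (C^-1 *: v)) := @metric_linear _ _ _ g x _.
pose gL : {scalar 'rV[R]_n} := HB.pack (fun u : tangent x => g x u (C^-1 *: v))
  (GRing.isLinear.Build _ _ _ _ _ gl).
have gl' : scalar (fun u : tangent x => g x u v) := @metric_linear _ _ _ g x _.
pose gL' : {scalar 'rV[R]_n} := HB.pack (fun u : tangent x => g x u v)
  (GRing.isLinear.Build _ _ _ _ _ gl').
pose aL : {scalar 'rV[R]_n} := HB.pack (a x) (GRing.isLinear.Build _ _ _ _ _ la).
have gE : g x (C^-1 *: v) (C^-1 *: v) = C^-1 * (C^-1 * g x v v).
  have := linearZ_LR gL C^-1 v => /= ->; congr (_ * _).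
  rewrite (Defs.metric_sym g v); exact: (linearZ_LR gL' C^-1 v).
have : (`|a x (C^-1 *: v)|%:E <= e%:E)%E.
  apply: le_trans ae; apply: le_trans (ereal_sup_ubound _); last first.
    by exists x.
  apply: ereal_sup_ubound; exists (C^-1 *: v) => //=.
  by rewrite gE mulrA -invfM -expr2 ler_pdivrMl ?exprn_gt0// mulr1.
rewrite lee_fin; have := linearZ_LR aL C^-1 v => /= ->.
by rewrite normrM gtr0_norm ?invr_gt0// ler_pdivrMl// mulrC.
Qed.

End forms.

Lemma ereal_cvg0_lt (R : realType) (u : nat -> \bar R) (e : R) :
  u i @[i --> \oo] --> 0%E -> 0 < e ->
  exists N, forall i, (N <= i)%N -> (u i < e%:E)%E.
Proof.
move=> u0 e0; have n0 : nbhs (0%E : \bar R) [set y | (y < e%:E)%E].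
  by apply: open_ereal_lt'; rewrite lte_fin.
by have [N _ HN] := u0 _ n0; exists N => i Ni; exact: HN.
Qed.

(** * Limits of pullbacks *)

(** If [F] is a primitive of [a] in the chart [d], then [F \o d \o f] is a local
    primitive of the pullback of [a]; this is its derivative along a coordinate
    line of the chart [c]. *)
Lemma pullback_derive_line (R : realType) n (M : manifold R n)
    (f : M -> M) (a : cofield M) (c d : chart R n M) (F : 'rV[R]_n -> R)
    (z v : 'rV[R]_n) (t : R) :
  smooth_map f -> atlas c -> atlas d -> chart_img c (z + t *: v) ->
  chart_dom d (f (chart_inv c (z + t *: v))) ->
  is_diff (d (f (chart_inv c (z + t *: v)))) F
    (coef a d ^~ (d (f (chart_inv c (z + t *: v))))) ->
  is_derive t 1 (fun u => F (d (f (chart_inv c (z + u *: v)))))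
    (coef (pullback f a) c v (z + t *: v)).
Proof.
move=> sf ac ad; set y := z + t *: v => cy dy dF.
pose Phi := d \o f \o chart_inv c.
have [cx yE] := chart_img_inv cy.
have dPhi : differentiable Phi y.
  by rewrite -yE; exact: smooth_map_differentiable.
have dc : is_diff y (F \o Phi) (coef a d ^~ (Phi y) \o 'd Phi y).
  exact: (is_diff_comp (differentiableP dPhi) dF).
have := is_derive_line (ex_diff (is_diff_def := dc)).
rewrite deriveE; last by case: dc.
rewrite (diff_val_app v dc) (coef_pullback _ _ sf ac ad cy dy); exact.
Qed.

Theorem lemma2 (R : realType) (n : nat) (M : manifold R n)
  (g : riemannian_metric M)
  (Mconn : connected [set: M]%classic) (Mcomp : compact [set: M]%classic)
  (Morient : orientable M)
  (psi_ : nat -> M -> M) (psi : M -> M)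
  (psi_diff : forall i : nat, diffeomorphism (psi_ i))
  (psidiff : diffeomorphism psi)
  (psi_cvg : C0_cvg g psi_ psi)
  (eta theta : one_form M)
  (eta_closed : closed_form eta)
  (cvg_theta : uniform_cvg g (fun i => pullback (psi_ i) eta) theta) :
  form_val theta = pullback psi eta.
Proof.
apply: functional_extensionality_dep => x0; apply: funext => v.
pose c := chart_at x0; pose z0 := c x0; pose d := chart_at (psi x0).
have ac : atlas c := chart_at_atlas _; have ad : atlas d := chart_at_atlas _.
have cx0 : chart_dom c x0 := chart_at_dom _.
have dx0 : chart_dom d (psi x0) := chart_at_dom _.
have cz0 : chart_img c z0 := chart_img_map cx0.
have spsi : smooth_map psi := psidiff.1.
have spsi_ i : smooth_map (psi_ i) := (psi_diff i).1.
pose y0 := d (psi x0).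
have dy0 : chart_img d y0 := chart_img_map dx0.
have [r1 r10 dist] := riemannian_dist_chart g ad dy0.
have [r2 r20 [F dF]] := closed_form_primitive eta_closed ad dy0.
(* Points within r of the ball of radius r around y0 are still in the domains of
   validity of both the distance estimate and the primitive. *)
pose r := Num.min r1 r2 / 2.
have r0 : 0 < r by rewrite divr_gt0// lt_min r10 r20.
have rr : r + r = Num.min r1 r2 by rewrite /r -splitr.
have [rr1 rr2] : r + r <= r1 /\ r + r <= r2 by rewrite rr !ge_min !lexx orbT.
pose z (t : R) := z0 + t *: v; pose x t := chart_inv c (z t).
have z_0 : z 0 = z0 by rewrite /z scale0r addr0.
have x_0 : x 0 = x0 by rewrite /x z_0 chart_invK.
have cz : {for 0, continuous z}.
  by apply: cvgD; [exact: cvg_cst|exact: scalel_continuous].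
have cx : {for 0, continuous x}.
  apply: (@continuous_comp _ _ _ z (chart_inv c)); first exact: cz.
  by rewrite z_0; exact: chart_inv_continuous.
(* C bounds the Riemannian norm of the coordinate vector v near x0. *)
pose C := `|metric_coef g c z0 v v| + 1.
have C0 : 0 < C by rewrite ltr_wpDl.
have [delta delta0 near0] : exists2 delta, 0 < delta & forall t, 0 <= t <= delta ->
   [/\ chart_img c (z t), chart_dom d (psi (x t)), `|d (psi (x t)) - y0| < r
     & metric_coef g c (z t) v v <= C ^+ 2].
  have n1 : \forall t \near (0 : R), chart_img c (z t).
    by apply: cz; rewrite z_0; exact: chart_img_nbhs.
  have cpx : {for 0, continuous (psi \o x)}.
    by apply: (@continuous_comp _ _ _ x psi); [exact: cx|exact: spsi.1].
  have n2 : \forall t \near (0 : R), chart_dom d (psi (x t)).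
    by apply: cpx; rewrite /= x_0; exact: chart_dom_nbhs.
  have n3 : \forall t \near (0 : R), `|d (psi (x t)) - y0| < r.
    have cdp : {for 0, continuous (d \o (psi \o x))}.
      apply: (@continuous_comp _ _ _ (psi \o x) d); first exact: cpx.
      by rewrite /= x_0; exact: chart_continuous.
    apply: filterS ((cvgrPdist_lt _ _).1 cdp _ r0) => t.
    by rewrite /= x_0 distrC.
  have n4 : \forall t \near (0 : R), metric_coef g c (z t) v v < C ^+ 2.
    have cq : {for 0, continuous (fun t => metric_coef g c (z t) v v)}.
      apply: (@continuous_comp _ _ _ z (fun z => metric_coef g c z v v)).
        exact: cz.
      by rewrite z_0; exact: metric_coef_continuous.
    apply: (cvgr_lt _ cq); rewrite z_0.
    rewrite /C; move: (metric_coef _ _ _ _ _) => q.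
    have := ler_norm q; have := normr_ge0 q; nra.
  have [e e0 He] := (near_normP _ _).1 (filterI (filterI n1 n2) (filterI n3 n4)).
  exists (e / 2); first by rewrite divr_gt0.
  move=> t /andP[t0 te]; have [|[? ?] [? ?]] := He t.
    by rewrite subr0 ger0_norm//; lra.
  by split=> //; exact: ltW.
have dist_lt e : 0 < e -> exists N, forall i t, (N <= i)%N -> 0 <= t <= delta ->
    chart_dom d (psi_ i (x t)) /\ `|d (psi_ i (x t)) - d (psi (x t))| < e.
  move=> e0; have [k k0 Hk] := dist _ e0.
  have [N HN] := ereal_cvg0_lt psi_cvg k0.
  exists N => i t Ni /near0[_ dt tr _]; apply: Hk => //.
    by apply: lt_le_trans tr _; lra.
  apply: le_lt_trans (HN i Ni); apply: ereal_sup_ubound; by exists (x t).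
have [N HN] := dist_lt _ r0.
pose h (t : R) := coef theta c v (z t).
pose f (t : R) := F (d (psi (x t))).
pose f_ i (t : R) := F (d (psi_ i (x t))).
have df_ i t : (N <= i)%N -> 0 <= t <= delta ->
    is_derive t 1 (f_ i) (coef (pullback (psi_ i) eta) c v (z t)).
  move=> Ni t01; have [czt _ tr _] := near0 _ t01; have [dit itr] := HN i t Ni t01.
  apply: pullback_derive_line => //; apply: dF.
  have := ler_distD (d (psi (x t))) (d (psi_ i (x t))) y0; rewrite -/(z t) -/(x t); lra.
have df : is_derive (0 : R) 1 f (coef (pullback psi eta) c v z0).
  have [czt dt tr _] := near0 0 (introT andP (conj (lexx 0) (ltW delta0))).
  have := @pullback_derive_line _ _ _ psi eta c d F z0 v 0 spsi ac ad czt dt.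
  by rewrite -/(z 0) z_0; apply; rewrite -z_0; apply: dF; lra.
have unif e : 0 < e -> exists N', forall i t, (N' <= i)%N -> 0 <= t <= delta ->
    `|coef (pullback (psi_ i) eta) c v (z t) - h t| <= e.
  move=> e0; have eC0 : 0 < e / C by rewrite divr_gt0.
  have [N' HN'] := ereal_cvg0_lt cvg_theta eC0.
  exists N' => i t N'i /near0[_ _ _ tC].
  rewrite -[leRHS](divfK (lt0r_neq0 C0)).
  have lpull := @pullback_linear _ _ _ (psi_ i) eta (@form_linear _ _ _ eta) (x t).
  have sc := scalar_sub lpull (@form_linear _ _ _ theta (x t)).
  exact: (@sup_norm_bound _ _ _ _ _ (e / C) C (x t) (vec_of c (x t) v) sc
     (ltW (HN' i N'i)) C0 tC).
have ptw t : 0 <= t <= delta -> f_ i t @[i --> \oo] --> f t.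
  move=> t01; have [_ _ tr _] := near0 _ t01.
  have cF : {for d (psi (x t)), continuous F}.
    apply: differentiable_continuous; have [|//] := dF (d (psi (x t))).
    lra.
  apply: (@cvg_comp _ _ _ (fun i => d (psi_ i (x t))) F); last exact: cF.
  apply/cvgrPdist_lt => e e0; have [N' HN'] := dist_lt _ e0.
  by exists N' => // i /= N'i; rewrite distrC; exact: (HN' i t N'i t01).2.
have ch : {for 0, continuous h}.
  apply: (@continuous_comp _ _ _ z (coef theta c v)); first exact: cz.
  rewrite z_0; apply: differentiable_continuous.
  exact: (smooth_on_differentiable (form_smooth theta ac v)).
have := derivative_of_uniform_limit delta0 df_ unif ptw ch df.
by rewrite /h z_0 !coef_chart_at => ->.
Qed.
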